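(* Let $R$ be a unital ring and $a,c\in R$. Then the following are equivalent: (1) there exists $y\in R$ such that $aya=a$, $yay=y$ and $Ry=Rc$; (2) $a$ is regular, $Rca=Ra$ and ${}^{\circ}(ca)={}^{\circ}c$; (3) $a$ is regular and $R={}^{\circ}a\oplus Rc$.
   Context: For $x\in R$: $Rx=\{rx\mid r\in R\}$, ${}^{\circ}x=\{r\in R\mid rx=0\}$. An element $x\in R$ is regular if there exists $z\in R$ with $xzx=x$. The symbol $\oplus$ denotes the internal direct sum of left ideals (sum equal to $R$, intersection $\{0\}$). *)

(* Defs.v *)
From mathcomp Require Import all_boot all_algebra.
From mathcomp Require Import boolp classical_sets.

Set Implicit Arguments.
Unset Strict Implicit.
Unset Printing Implicit Defensive.

Import GRing.Theory.
Local Open Scope classical_set_scope.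
Local Open Scope ring_scope.

(* Rings are [pzRingType]s: unital, not necessarily commutative, and the zero
   ring is allowed. *)

Definition left_principal (R : pzRingType) (x : R) : set R :=
  [set r * x | r in [set: R]].

Definition left_annihilator (R : pzRingType) (x : R) : set R :=
  [set r | r * x = 0].

(* Regular in the sense of von Neumann, unlike [GRing.lreg] and [GRing.rreg],
   which are cancellation properties. *)
Definition vn_regular (R : pzRingType) (x : R) : Prop :=
  exists z : R, x * z * x = x.

Definition direct_sum_decomposition (R : pzRingType) (I J : set R) : Prop :=
  [set u + v | u in I & v in J] = [set: R] /\ I `&` J = [set 0].

(* Main.v *)
Require Import Defs.
From mathcomp Require Import all_boot all_algebra.
From mathcomp Require Import boolp classical_sets.

Set Implicit Arguments.
Unset Strict Implicit.
Unset Printing Implicit Defensive.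

Import GRing.Theory.
Local Open Scope classical_set_scope.
Local Open Scope ring_scope.

(** Everything reduces to two elementary conditions on [a] and [c]: an equation
    [a = s * c * a] for some [s], and the implication
    [r * c * a = 0 -> r * c = 0] for all [r].  The first says both that
    [Rca = Ra] and that the left annihilator of [a] and [Rc] span [R], since
    [1 = (1 - s * c) + s * c] and [1 - s * c] kills [a].  The second says both
    that [ca] and [c] have the same left annihilator and that the left
    annihilator of [a] meets [Rc] trivially.  So (2) and (3) agree clause by
    clause.

    Given (1), writing [y = p * c] and [c = q * y] yields the first condition
    from [a = a * y * a] and the second from [c * a * y = c].  Conversely, if
    [a * z * a = a], the element [y = z * s * c] is the required inverse: it is
    visibly an inner inverse of [a], and then [c * a * y - c] kills [a], so that
    cancellation gives [c * a * y = c].  This one identity makes [y] an outer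
    inverse and puts [c] in [Ry]. *)

Lemma left_principal_subP (R : pzRingType) (x y : R) :
  left_principal x `<=` left_principal y <-> exists s, x = s * y.
Proof.
split=> [sub|[s ->] _ [r _ <-]]; last by exists (r * s); rewrite ?mulrA.
by have [|s _ <-] := sub x; [exists 1; rewrite ?mul1r | exists s].
Qed.

Lemma left_principal_mul_eqP (R : pzRingType) (a c : R) :
  left_principal (c * a) = left_principal a <-> exists s, a = s * c * a.
Proof.
split=> [eq_ca|[s def_a]].
  have /left_principal_subP[s def_a] :
    left_principal a `<=` left_principal (c * a) by rewrite eq_ca.
  by exists s; rewrite -mulrA.
apply/seteqP; split; apply/left_principal_subP; first by exists c.
by exists s; rewrite mulrA.
Qed.

Lemma left_annihilator_mul_eqP (R : pzRingType) (a c : R) :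
  left_annihilator (c * a) = left_annihilator c <->
  forall r, r * c * a = 0 -> r * c = 0.
Proof.
split=> [eq_ca r rca0|can_a].
  suff: left_annihilator (c * a) r by rewrite eq_ca.
  by rewrite /left_annihilator/= mulrA.
apply/seteqP; split=> r; rewrite /left_annihilator/= mulrA; first exact: can_a.
by move=> ->; rewrite mul0r.
Qed.

(** A sum of left ideals is everything as soon as it contains [1]; splitting
    [1 = u + s * c] with [u * a = 0] and multiplying by [a] on the right gives
    [a = s * c * a], and each such [s] gives back the splitting. *)
Lemma left_annihilator_add_principalP (R : pzRingType) (a c : R) :
  [set u + v | u in left_annihilator a & v in left_principal c] = [set: R] <->
  exists s, a = s * c * a.
Proof.
split=> [sumT|[s def_a]].
  have : [set: R] 1 by [].
  rewrite -sumT => -[u ua0 [_ [s _ <-] eq1]]; exists s.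
  by rewrite -[LHS]mul1r -eq1 mulrDl ua0 add0r.
apply/seteqP; split=> // r _; exists (r * (1 - s * c)).
  by rewrite /left_annihilator/= -mulrA mulrBl mul1r -def_a subrr mulr0.
exists (r * s * c); first by exists (r * s).
by rewrite mulrBr mulr1 mulrA subrK.
Qed.

Lemma left_annihilator_cap_principalP (R : pzRingType) (a c : R) :
  left_annihilator a `&` left_principal c = [set 0] <->
  forall r, r * c * a = 0 -> r * c = 0.
Proof.
split=> [cap0 r rca0|can_a].
  have : (left_annihilator a `&` left_principal c) (r * c).
    by split=> //; exists r.
  by rewrite cap0.
apply/seteqP; split=> [x [xa0 [r _ def_x]]|_ ->].
  by move: xa0; rewrite -def_x; exact: can_a.
split; first exact: mul0r.
by exists 0; rewrite ?mul0r.
Qed.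

(** The pivot is the identity [c * a * y = c].  Given it, [r * c] is
    [(r * c * a) * y] and so vanishes with [r * c * a].  Conversely, when [y]
    is both an inner inverse of [a] and a left multiple of [c], the difference
    [c * a * y - c] is a left multiple of [c] killed by [a], and the
    cancellation hypothesis makes it zero. *)
Lemma reflexive_inverse_left_principalP (R : pzRingType) (a c : R) :
  (exists y : R, [/\ a * y * a = a, y * a * y = y &
                     left_principal y = left_principal c]) <->
  [/\ vn_regular a, exists s, a = s * c * a &
      forall r, r * c * a = 0 -> r * c = 0].
Proof.
split=> [[y [aya yay /seteqP[]]]|[[z aza] [s def_a] can_a]].
  move=> /left_principal_subP[p def_y] /left_principal_subP[q def_c].
  have cay : c * a * y = c by rewrite {1}def_c -!mulrA [y * _]mulrA yay.
  split=> [| |r rca0]; first by exists y.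
    by exists (a * p); rewrite -(mulrA a) -def_y.
  by rewrite -cay !mulrA rca0 mul0r.
pose y := z * s * c.
have aya : a * y * a = a.
  by rewrite /y -!mulrA (mulrA s) -def_a mulrA.
have cay : c * a * y = c.
  (* [c * a * z * s - 1] is the left cofactor of [c] in [c * a * y - c]. *)
  have /can_a : (c * a * z * s - 1) * c * a = 0.
    rewrite !mulrBl mul1r -!mulrA (mulrA s) -def_a.
    by rewrite (mulrA a) aza subrr.
  by rewrite mulrBl mul1r => /subr0_eq; rewrite /y !mulrA.
exists y; split=> //; first by rewrite {1}/y -!mulrA (mulrA c) cay /y mulrA.
apply/seteqP; split; apply/left_principal_subP; first by exists (z * s).
by exists (c * a); rewrite cay.
Qed.

Theorem theorem3p15 (R : pzRingType) (a c : R) :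
  ((exists y : R, [/\ a * y * a = a, y * a * y = y &
                      left_principal y = left_principal c])
   <->
   [/\ vn_regular a,
       left_principal (c * a) = left_principal a &
       left_annihilator (c * a) = left_annihilator c])
  /\
  ([/\ vn_regular a,
       left_principal (c * a) = left_principal a &
       left_annihilator (c * a) = left_annihilator c]
   <->
   (vn_regular a /\
    direct_sum_decomposition (left_annihilator a) (left_principal c))).
Proof.
rewrite /direct_sum_decomposition reflexive_inverse_left_principalP.
rewrite left_annihilator_add_principalP left_annihilator_cap_principalP.
rewrite (propext (left_principal_mul_eqP _ _)).
rewrite (propext (left_annihilator_mul_eqP _ _)).
by split=> //; split=> [[]|[? []]].
Qed.
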